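(* Let $\lambda<1$, $\lambda\ne 0$, $q=1-\lambda>0$, and consider a $\lambda$-exponential family with divisive potential $\varphi_\lambda$ and natural parameter set $\Omega$, such that $\Omega$ is a non-empty open convex set and $\varphi_\lambda$ may be differentiated under the integral sign as many times as needed. Then the function $\vartheta\mapsto\frac{1}{\lambda}\left(e^{\lambda\varphi_\lambda(\vartheta)}-1\right)$ is convex on $\Omega$. Moreover, $1-\lambda\,\nabla\varphi_\lambda(\vartheta)\cdot\vartheta>0$ for every $\vartheta\in\Omega$.
   Context: Notation: $t_+=\max\{t,0\}$, and $0^{s}=\infty$ for $s<0$. The $q$-exponential function is $\exp_q(t)=[1+(1-q)t]_+^{1/(1-q)}=[1+\lambda t]_+^{1/\lambda}\in[0,\infty]$. $\lambda$-exponential family: let $\nu$ be a measure on a measurable space $\mathcal{X}$ and $F=(F_1,\dots,F_d):\mathcal{X}\to\mathbb{R}^d$ measurable. The divisive $\lambda$-potential is $\varphi_\lambda(\vartheta)=\log\int \exp_q(\vartheta\cdot F(x))\,d\nu(x)$, the natural parameter set is $\Omega=\{\vartheta\in\mathbb{R}^d:\varphi_\lambda(\vartheta)<\infty\}$, and the family consists of the probability densities $p_\vartheta(x)=\exp_q(\vartheta\cdot F(x))e^{-\varphi_\lambda(\vartheta)}$, $\vartheta\in\Omega$ (so $\varphi_\lambda$ is finite on $\Omega$). ''Differentiable under the integral sign'' means: $\varphi_\lambda$ is smooth on $\Omega$ and the derivatives of $e^{\varphi_\lambda(\vartheta)}=\int[1+\lambda\vartheta\cdot F]_+^{1/\lambda}\,d\nu$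 are obtained by integrating the corresponding $\vartheta$-derivatives of the integrand; in particular $\nabla e^{\varphi_\lambda(\vartheta)}=\int[1+\lambda\vartheta\cdot F]_+^{1/\lambda-1}F\,d\nu$ with $\nu$-integrable integrand. *)

(* Defs.v *)
From HB Require Import structures.
From mathcomp Require Import all_boot all_order all_algebra.
From mathcomp Require Import all_classical all_reals all_analysis.

Set Implicit Arguments.
Unset Strict Implicit.
Unset Printing Implicit Defensive.

Import Order.TTheory GRing.Theory Num.Theory.
Import numFieldNormedType.Exports.

Local Open Scope classical_set_scope.
Local Open Scope ring_scope.

(** * Calculus on R^n, with vectors as rows *)

Definition dot (R : realType) (n : nat) (u v : 'rV[R]_n) : R :=
  \sum_(i < n) u 0 i * v 0 i.

Definition grad (R : realType) (n : nat) (f : 'rV[R]_n -> R) (v : 'rV[R]_n) :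
    'rV[R]_n :=
  \row_i 'D_(delta_mx 0 i) f v.

(** For [s = [:: i1; ...; ik]], the k-th order partial derivative
    [d_i1 (... (d_ik f))]. As ['D] is total, this is meaningful at [v] only
    when [has_partial s f v] holds. *)
Fixpoint partial (R : realType) (n : nat) (s : seq 'I_n)
    (f : 'rV[R]_n -> R) : 'rV[R]_n -> R :=
  if s is i :: s' then fun v => 'D_(delta_mx 0 i) (partial s' f) v else f.

Fixpoint has_partial (R : realType) (n : nat) (s : seq 'I_n)
    (f : 'rV[R]_n -> R) (v : 'rV[R]_n) : Prop :=
  if s is i :: s' then
    (\forall w \near v, has_partial s' f w) /\
    derivable (partial s' f) v (delta_mx 0 i)
  else True.

(** C^oo on [D], meant for open [D]: the partial derivatives of all orders are
    Frechet differentiable (in particular continuous) at every point of [D]. *)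
Definition smooth_on (R : realType) (n : nat) (D : set 'rV[R]_n)
    (f : 'rV[R]_n -> R) : Prop :=
  forall (s : seq 'I_n) (v : 'rV[R]_n), D v -> differentiable (partial s f) v.

(** * The q-exponential and lambda-exponential families *)

(** [t]_+ ^ s in [0, +oo], with 0 ^ s = +oo for s < 0; the test is needed
    because the library sets [0 `^ s = 0] for every [s != 0]. *)
Definition pospowe (R : realType) (t s : R) : \bar R :=
  if (t <= 0) && (s < 0) then +oo%E else ((Num.max t 0) `^ s)%:E.

Definition expq (R : realType) (q t : R) : \bar R :=
  pospowe (1 + (1 - q) * t) (1 - q)^-1.

Definition divisive_potential (R : realType) (d : measure_display)
    (X : measurableType d) (nu : {measure set X -> \bar R}) (n : nat)
    (F : X -> 'rV[R]_n) (lambda : R) (theta : 'rV[R]_n) : \bar R :=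
  lne (\int[nu]_x expq (1 - lambda) (dot theta (F x))).

Definition natural_parameters (R : realType) (d : measure_display)
    (X : measurableType d) (nu : {measure set X -> \bar R}) (n : nat)
    (F : X -> 'rV[R]_n) (lambda : R) : set 'rV[R]_n :=
  [set theta | (divisive_potential nu F lambda theta < +oo)%E].

(** [fine] only discards values that do not matter here: the potential is finite
    on the natural parameter set of a lambda-exponential family, and the
    integrand of an integral that is not +oo is finite almost everywhere. *)
Definition real_potential (R : realType) (d : measure_display)
    (X : measurableType d) (nu : {measure set X -> \bar R}) (n : nat)
    (F : X -> 'rV[R]_n) (lambda : R) (theta : 'rV[R]_n) : R :=
  fine (divisive_potential nu F lambda theta).

Definition integrand (R : realType) (n : nat) (lambda : R)
    (y theta : 'rV[R]_n) : R :=
  fine (expq (1 - lambda) (dot theta y)).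

(** The data [(nu, F)] define a lambda-exponential family: the potential is also
    different from -oo on the natural parameter set, so that the densities
    [expq (1 - lambda) (theta . F x) * exp (- potential)] have integral 1. *)
Definition lambda_exponential_family (R : realType) (d : measure_display)
    (X : measurableType d) (nu : {measure set X -> \bar R}) (n : nat)
    (F : X -> 'rV[R]_n) (lambda : R) : Prop :=
  (forall i : 'I_n, measurable_fun setT (fun x => F x 0 i)) /\
  (forall theta, natural_parameters nu F lambda theta ->
     divisive_potential nu F lambda theta \is a fin_num).

(** The potential is smooth and, up to order [N], the partial derivatives of its
    exponential are the integrals of those of the integrand. The latter need
    only exist for almost every [x]: [[1 + lambda * t]_+ `^ lambda^-1] is not
    infinitely differentiable at [t = - lambda^-1]. The function [h] is an
    integrable version of this almost everywhere defined derivative.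
    [N] is a parameter because differentiation at all orders fails in the
    typical families with 0 < lambda, whose supports move with theta
    (e.g. compactly supported q-Gaussians), whereas they allow two orders. *)
Definition diff_under_integral (R : realType) (d : measure_display)
    (X : measurableType d) (nu : {measure set X -> \bar R}) (n : nat)
    (F : X -> 'rV[R]_n) (lambda : R) (N : nat) : Prop :=
  smooth_on (natural_parameters nu F lambda) (real_potential nu F lambda) /\
  forall (s : seq 'I_n) (theta : 'rV[R]_n), (size s <= N)%N ->
    natural_parameters nu F lambda theta ->
    exists h : X -> R,
      [/\ nu.-integrable setT (EFin \o h),
          {ae nu, forall x, has_partial s (integrand lambda (F x)) theta /\
                            partial s (integrand lambda (F x)) theta = h x} &
          partial s (fun v => expR (real_potential nu F lambda v)) theta =
            \int[nu]_x h x].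

(* Main.v *)
(** With [s = 1 / lambda] and [Z = exp phi], [Z ^ lambda] is the "[L^s] norm" of
    [[1 + lambda * theta . F]_+], whose base is affine in [theta] and where
    [t |-> [t]_+ ^ s] is convex with values in [[0, +oo]] as [s < 0] or [1 < s].
    Hence Minkowski's inequality ([0 < lambda]) makes [Z ^ lambda] convex and
    its reverse ([lambda < 0]) makes it concave; both cases follow by
    normalising, using convexity pointwise, and integrating.

    For the gradient, [Z - lambda * theta . grad Z] is the integral of
    [u ^ s - lambda * (theta . F) * u ^ (s - 1) = u ^ (s - 1)] over the set where
    [u = 1 + lambda * theta . F] is positive, and this set is not negligible
    since [Z != 0]. Dividing by [Z] gives the claim. *)
Require Import Defs.
From HB Require Import structures.
From mathcomp Require Import all_boot all_order all_algebra.
From mathcomp Require Import all_classical all_reals all_analysis.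
From mathcomp Require Import unstable measurable_realfun.
From mathcomp Require Import ring lra.

Set Implicit Arguments.
Unset Strict Implicit.
Unset Printing Implicit Defensive.

Import Order.TTheory GRing.Theory Num.Theory.
Import numFieldNormedType.Exports.

Local Open Scope classical_set_scope.
Local Open Scope ring_scope.

(** * Homogeneity, measurability and convexity of the extended power *)

Section pospowe.
Context {R : realType}.
Implicit Types (s t a b c p q : R).

Lemma pospowe_ge0 t s : (0 <= pospowe t s)%E.
Proof. by rewrite /pospowe; case: ifP => // _; rewrite lee_fin powR_ge0. Qed.

Lemma pospowe_gt0E t s : 0 < t -> pospowe t s = (t `^ s)%:E.
Proof. by move=> t0; rewrite /pospowe leNgt t0/= max_l// ltW. Qed.

(** Scaling by [c > 0] preserves the sign test, and [c^s * +oo = +oo], so homogeneity survives at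
    the infinite values. *)
Lemma pospoweM c t s : 0 < c ->
  pospowe (c * t) s = ((c `^ s)%:E * pospowe t s)%E.
Proof.
move=> c0; rewrite /pospowe pmulr_rle0//; case: ifP => _.
  by rewrite gt0_muley// lte_fin powR_gt0.
have m0 : 0 <= Num.max t 0 by rewrite le_max lexx orbT.
by rewrite -EFinM -(powRM s (ltW c0) m0) maxr_pMr ?mulr0// ltW//.
Qed.

Lemma measurable_fun_pospowe d (T : measurableType d) (f : T -> R) s :
  measurable_fun setT f -> measurable_fun setT (fun x => pospowe (f x) s).
Proof.
move=> mf; apply: measurable_fun_ifT.
- by apply: measurable_and => //; exact: measurable_fun_ler.
- exact: measurable_cst.
- apply/measurable_EFinP; apply: measurableT_comp (measurable_powR s) _.
  exact: measurable_maxr.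
Qed.

(** For [1 <= s], [t^s] is convex and nondecreasing on nonnegative reals and the positive part is
    convex. For [s < 0], the right side is [+oo] unless [a, b > 0]; then [t^s = exp (s * ln t)],
    where [s * ln t] is convex because [ln] is concave, and [exp] is increasing and convex. *)
Lemma convex_pospowe s p q a b : s < 0 \/ 1 <= s ->
  0 < p -> 0 < q -> p + q = 1 ->
  (pospowe (p * a + q * b) s <=
   p%:E * pospowe a s + q%:E * pospowe b s)%E.
Proof.
move=> s01 p0 q0 pq1.
have p1 : p <= 1 by lra.
pose t := Itv01 (ltW p0) p1.
have cE (x y : R^o) : conv t x y = p * x + q * y.
  by rewrite convRE; congr (_ + _ * _); rewrite /onem/=; lra.
case: s01 => [s0|s1]; last first.
  rewrite /pospowe; have -> : (s < 0) = false by lra.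
  rewrite !andbF -!EFinM -EFinD lee_fin.
  have m0 (x : R) : 0 <= Num.max x 0 by rewrite le_max lexx orbT.
  set a' := Num.max a 0; set b' := Num.max b 0.
  have c0 : 0 <= p * a' + q * b'.
    by rewrite addr_ge0// mulr_ge0 ?m0 ?(ltW p0) ?(ltW q0).
  have : (p * a' + q * b') `^ s <= p * a' `^ s + q * b' `^ s.
    rewrite -(cE a' b') -(cE (a' `^ s) (b' `^ s)).
    by apply: (@convex_powR R s s1 t a' b'); rewrite inE/= in_itv/= andbT m0.
  apply: le_trans; apply: (@ge0_ler_powR _ s); rewrite ?nnegrE ?m0 ?c0//.
    by lra.
  rewrite ge_max c0 andbT.
  by apply: lerD; rewrite ler_pM2l// le_max lexx.
have [a0|a0] := leP a 0.
  rewrite /(pospowe a s) a0 s0/= gt0_muley ?lte_fin// addye ?leey//.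
  (* The other summand is nonnegative, hence not [-oo], so the sum is indeed [+oo]. *)
  by rewrite gt_eqF// (lt_le_trans (ltNyr 0))// mule_ge0 ?pospowe_ge0// lee_fin ltW.
have [b0|b0] := leP b 0.
  rewrite /(pospowe b s) b0 s0/= gt0_muley ?lte_fin// addey ?leey//.
  by rewrite gt_eqF// (lt_le_trans (ltNyr 0))// mule_ge0 ?pospowe_ge0// lee_fin ltW.
have c0 : 0 < p * a + q * b by rewrite addr_gt0 ?mulr_gt0.
rewrite !pospowe_gt0E// -!EFinM -EFinD lee_fin /powR !gt_eqF//.
apply: le_trans (_ : expR (p * (s * ln a) + q * (s * ln b)) <= _).
  have := concave_ln t a0 b0; rewrite !cE ler_expR => ?; nra.
by have := convex_expR t (s * ln a) (s * ln b); rewrite !cE.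
Qed.

End pospowe.

(** * Directional derivatives: restriction to lines, minima, exponentials *)

Section directional_derivative.
Context {R : realType} {V : normedModType R}.
Implicit Types (f : V -> R) (u v : V).

(** Both sides have the same difference quotients; this gives access to the one-variable chain
    rule. *)
Lemma is_derive_line f v u (l : R) :
  is_derive (0 : R) 1 (fun h : R => f (h *: u + v)) l <-> is_derive v u f l.
Proof.
have E : (fun h : R => h^-1 *: (((fun k : R => f (k *: u + v)) \o shift 0)
      (h *: 1) - f (0 *: u + v))) =
    (fun h : R => h^-1 *: ((f \o shift v) (h *: u) - f v)).
  by apply/funext => h /=; rewrite addr0 scale0r add0r [h *: 1]mulr1.
by split=> -[df <-]; split; move: df; rewrite /derivable /derive E.
Qed.

(** At a minimum the difference quotients are nonpositive from the left and nonnegative from the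
    right. *)
Lemma derive_min f v u : (forall w, f v <= f w) -> derivable f v u ->
  'D_u f v = 0.
Proof.
move=> fmin df; apply/eqP; rewrite eq_le; apply/andP; split.
  rewrite /derive cvg_at_leftE//; apply: limr_le.
    by apply/cvg_ex; exists ('D_u f v); exact: cvg_dnbhs_at_left.
  near=> h; apply: mulr_le0_ge0; last by rewrite subr_ge0 fmin.
  by rewrite invr_le0 ltW//; near: h; exact: nbhs_left_lt.
rewrite /derive cvg_at_rightE//; apply: limr_ge.
  by apply/cvg_ex; exists ('D_u f v); exact: cvg_dnbhs_at_right.
near=> h; apply: mulr_ge0; last by rewrite subr_ge0 fmin.
by rewrite invr_ge0 ltW//; near: h; exact: nbhs_right_gt.
Unshelve. all: by end_near. Qed.

Lemma derive_expR_comp f v u : derivable f v u ->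
  'D_u (fun w => expR (f w)) v = expR (f v) * 'D_u f v.
Proof.
move=> df.
have /is_derive_line df1 : is_derive v u f ('D_u f v) by split.
have e0 : 0 *: u + v = v by rewrite scale0r add0r.
have : is_derive v u (fun w => expR (f w)) (expR (f v) * 'D_u f v).
  apply/is_derive_line; rewrite -[in expR _]e0.
  by apply: (is_derive1_comp (f := expR)).
by case.
Qed.

End directional_derivative.

(** * Strict positivity of integrals *)

Section Rintegral_positivity.
Context d (T : measurableType d) {R : realType} (mu : {measure set T -> \bar R}).

(** If [w] had integral [<= 0], then, being nonnegative almost everywhere, it would vanish almost
    everywhere; so would [h], whose integral would be [0]. *)
Lemma Rintegral_gt0 (h w : T -> R) :
  mu.-integrable setT (EFin \o h) -> mu.-integrable setT (EFin \o w) ->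
  {ae mu, forall x, 0 <= w x} -> {ae mu, forall x, w x = 0 -> h x = 0} ->
  \int[mu]_x h x != 0 -> 0 < \int[mu]_x w x.
Proof.
move=> ih iw w0 wh; rewrite ltNge; apply: contra => w_le0; apply/eqP.
have mw := measurable_int _ iw; have mh := measurable_int _ ih.
have wE : (\int[mu]_x (w x)%:E = \int[mu]_x `|(EFin \o w) x|)%E.
  apply: ae_eq_integral => //; first exact: measurableT_comp.
  by apply: filterS w0 => x w0 _ /=; rewrite ger0_norm.
have w_int0 : (\int[mu]_x `|(EFin \o w) x| = 0)%E.
  apply/eqP; rewrite eq_le integral_ge0 ?andbT// -wE.
  by rewrite -(fineK (integrable_fin_num _ iw)) ?lee_fin.
have /(ae_eq_integral_abs mu measurableT mw) w_ae0 := w_int0.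
rewrite /Rintegral (ae_eq_integral (cst 0)%E) ?integral0//.
apply: filterS2 wh w_ae0 => x wh wx _ /=.
by rewrite wh//; case: (wx I).
Qed.

End Rintegral_positivity.

(** * Linearity of the dot product in its first argument *)

Section dot.
Context {R : realType} (n : nat).
Implicit Types (u v y : 'rV[R]_n) (a : R).

Lemma dotDl u v y : dot (u + v) y = dot u y + dot v y.
Proof. by rewrite -big_split; apply: eq_bigr => i _; rewrite mxE mulrDl. Qed.

Lemma dotZl a u y : dot (a *: u) y = a * dot u y.
Proof. by rewrite mulr_sumr; apply: eq_bigr => i _; rewrite mxE mulrA. Qed.

Lemma dot_delta i y : dot (delta_mx 0 i) y = y 0 i.
Proof.
rewrite /dot (bigD1 i)//= big1 ?addr0 ?mxE ?eqxx ?mul1r// => j ji.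
by rewrite mxE eqxx (negbTE ji) mul0r.
Qed.

End dot.

Lemma expqE {R : realType} (lambda t : R) :
  expq (1 - lambda) t = pospowe (1 + lambda * t) lambda^-1.
Proof. by rewrite /expq subKr. Qed.

(** * Derivatives of the integrand and its Euler-type identity *)

Section integrand.
Context {R : realType} (n : nat) (lambda : R).
Context (lambda_neq0 : lambda != 0).
Implicit Types (y v : 'rV[R]_n).

Lemma integrand_ge0 y v : 0 <= integrand lambda y v.
Proof. by rewrite fine_ge0// expqE pospowe_ge0. Qed.

Lemma integrand_gt0E y v : 0 < 1 + lambda * dot v y ->
  integrand lambda y v = (1 + lambda * dot v y) `^ lambda^-1.
Proof. by move=> v0; rewrite /integrand expqE pospowe_gt0E. Qed.

(* Where the base is nonpositive the value is [0]: by [0 `^ s = 0] if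
   [0 < lambda], by [fine +oo = 0] if [lambda < 0]. *)
Lemma integrand_le0E y v : 1 + lambda * dot v y <= 0 ->
  integrand lambda y v = 0.
Proof.
move=> v0; rewrite /integrand expqE /pospowe v0/= max_r//.
by case: ifP => //= _; rewrite powR0// invr_eq0.
Qed.

Lemma is_derive_integrand y v i : 0 < 1 + lambda * dot v y ->
  is_derive v (delta_mx 0 i) (integrand lambda y)
    ((1 + lambda * dot v y) `^ (lambda^-1 - 1) * y 0 i).
Proof.
move=> v0; apply/is_derive_line.
have lineE (h : R) : 1 + lambda * dot (h *: delta_mx 0 i + v) y =
    lambda * y 0 i * h + (1 + lambda * dot v y).
  by rewrite dotDl dotZl dot_delta; ring.
pose g (h : R) := lambda * y 0 i * h + (1 + lambda * dot v y).
have g0 : g 0 = 1 + lambda * dot v y by rewrite /g mulr0 add0r.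
have dg : is_derive (0 : R) 1 g (lambda * y 0 i).
  by rewrite /g; apply: is_derive_eq; rewrite addr0 [_%:A]mulr1.
(* A positive base stays positive near [0], so there the integrand is an ordinary power along the
   line. *)
have near_g : \forall h \near (0 : R),
    (fun x => x `^ lambda^-1) (g h) = integrand lambda y (h *: delta_mx 0 i + v).
  have cg : {for 0, continuous g}.
    by apply: differentiable_continuous; apply/derivable1_diffP; case: dg.
  have : \forall h \near (0 : R), 0 < g h.
    by apply: (cvgr_gt _ cg); rewrite g0.
  by apply: filterS => h gh; rewrite integrand_gt0E lineE.
apply: (near_eq_is_derive near_g).
have gpos : 0 < g 0 by rewrite g0.
have := is_derive1_comp (is_derive1_powR lambda^-1 gpos) dg.
by rewrite g0 mulrACA mulVf// mul1r.
Qed.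

(** With [u = 1 + lambda * dot v y > 0] and [s = lambda^-1], this is
    [u^s - (u - 1) * u^(s - 1) = u^(s - 1)]. If [u <= 0], the integrand takes its minimum [0] at
    [v], so its partial derivatives, which exist by hypothesis, vanish. *)
Lemma euler_integrand y v :
  (forall i, derivable (integrand lambda y) v (delta_mx 0 i)) ->
  integrand lambda y v
    - lambda * \sum_i v 0 i * 'D_(delta_mx 0 i) (integrand lambda y) v =
  if 0 < 1 + lambda * dot v y then (1 + lambda * dot v y) `^ (lambda^-1 - 1)
  else 0.
Proof.
move=> dy; case: ltP => v0.
  rewrite integrand_gt0E//.
  under eq_bigr => i _.
    have -> := @derive_val _ _ _ _ _ _ _ (is_derive_integrand i v0).
    rewrite mulrCA; over.
  rewrite -mulr_sumr -/(dot v y).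
  have {1}-> : lambda^-1 = (lambda^-1 - 1) + 1 by ring.
  rewrite powRD ?(gt_eqF v0) ?implybT// powRr1 ?ltW//; ring.
rewrite integrand_le0E// big1 ?mulr0 ?subr0// => i _.
by rewrite derive_min ?mulr0// => w; rewrite integrand_le0E// integrand_ge0.
Qed.

End integrand.

(** * Minkowski's inequality and its reverse *)

Section minkowski.
Context d (T : measurableType d) {R : realType} (mu : {measure set T -> \bar R}).

(* Minkowski's inequality for [1 <= s] and its reverse for [s < 0], with
   [a] and [b] the norms [(\int f^s)^(1/s)] and [(\int g^s)^(1/s)]. *)
Lemma minkowski_pospowe (s p q a b : R) (f g : T -> R) :
  s < 0 \/ 1 <= s -> 0 < p -> 0 < q -> 0 < a -> 0 < b ->
  measurable_fun setT f -> measurable_fun setT g ->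
  (\int[mu]_x pospowe (f x) s = (a `^ s)%:E)%E ->
  (\int[mu]_x pospowe (g x) s = (b `^ s)%:E)%E ->
  (\int[mu]_x pospowe (p * f x + q * g x)%R s <= ((p * a + q * b) `^ s)%:E)%E.
Proof.
move=> s01 p0 q0 a0 b0 mf mg If Ig.
set c := p * a + q * b.
have pa0 : 0 < p * a by rewrite mulr_gt0.
have qb0 : 0 < q * b by rewrite mulr_gt0.
have c0 : 0 < c by rewrite addr_gt0.
(* Weights for which [(p * f + q * g) / c] is a convex combination of the normalised functions
   [f / a] and [g / b]. *)
pose P := p * a / c; pose Q := q * b / c.
have P0 : 0 < P by rewrite divr_gt0.
have Q0 : 0 < Q by rewrite divr_gt0.
have PQ : P + Q = 1 by rewrite -mulrDl divff// gt_eqF.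
have mpow (k : T -> R) : measurable_fun setT k ->
    measurable_fun setT (fun x => pospowe (k x) s).
  exact: measurable_fun_pospowe.
have normalized (k : T -> R) (r : R) : 0 < r -> measurable_fun setT k ->
    (\int[mu]_x pospowe (k x) s = (r `^ s)%:E)%E ->
    (\int[mu]_x pospowe (r^-1 * k x)%R s = 1)%E.
  move=> r0 mk Ik; under eq_integral do rewrite pospoweM ?invr_gt0//.
  rewrite ge0_integralZl//; [|exact: mpow|by move=> *; exact: pospowe_ge0|
    by rewrite lee_fin powR_ge0].
  by rewrite Ik -EFinM -powRM ?invr_ge0 ?ltW// mulVf ?gt_eqF// powR1.
have mfa : measurable_fun setT (fun x => a^-1 * f x) by exact: measurable_funM.
have mgb : measurable_fun setT (fun x => b^-1 * g x) by exact: measurable_funM.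
have mZ (r : R) (k : T -> R) : measurable_fun setT k ->
    measurable_fun setT (fun x => (r%:E * pospowe (k x) s)%E).
  by move=> mk; apply: emeasurable_funM => //; exact: mpow.
have Z_ge0 (r t : R) : 0 < r -> (0 <= r%:E * pospowe t s)%E.
  by move=> r0; rewrite mule_ge0 ?pospowe_ge0// lee_fin ltW.
have combE x : p * f x + q * g x = c * (P * (a^-1 * f x) + Q * (b^-1 * g x)).
  by rewrite /P /Q; field; rewrite !gt_eqF.
under eq_integral do rewrite combE pospoweM//.
have mcomb : measurable_fun setT
    (fun x => pospowe (P * (a^-1 * f x) + Q * (b^-1 * g x)) s).
  by apply: mpow; apply: measurable_funD; exact: measurable_funM.
rewrite ge0_integralZl//; [|by move=> *; exact: pospowe_ge0|
  by rewrite lee_fin powR_ge0].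
(* With [c^s] factored out, the remaining integral has to be at most [1 = P + Q]. *)
rewrite -[leRHS]mule1 lee_wpmul2l ?lee_fin ?powR_ge0//.
apply: (@le_trans _ _ (\int[mu]_x (P%:E * pospowe (a^-1 * f x)%R s +
                                   Q%:E * pospowe (b^-1 * g x)%R s))%E).
  apply: ge0_le_integral => //.
  - by move=> *; exact: pospowe_ge0.
  - by apply: emeasurable_funD; exact: mZ.
  - by move=> x _; exact: convex_pospowe.
rewrite ge0_integralD//; [|by move=> *; exact: Z_ge0|exact: mZ|
  by move=> *; exact: Z_ge0|exact: mZ].
rewrite !ge0_integralZl//;
  try by [exact: mpow|move=> *; exact: pospowe_ge0|rewrite lee_fin ltW].
by rewrite !normalized// !mule1 -EFinD PQ.
Qed.

End minkowski.

(** * The two claims about the potential *)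

Section divisive_potential.
Context {R : realType} d (X : measurableType d) (nu : {measure set X -> \bar R}).
Context (n : nat) (F : X -> 'rV[R]_n) (lambda : R).
Context (lambda_neq0 : lambda != 0).
Let phi := real_potential nu F lambda.
Let Omega := natural_parameters nu F lambda.

Lemma convex_divisive_potential : lambda < 1 ->
  lambda_exponential_family nu F lambda -> convex_set Omega ->
  convex_function Omega
    (fun theta => lambda^-1 * (expR (lambda * phi theta) - 1)).
Proof.
move=> lambda_lt1 [mF fin_pot] Omega_convex.
have integral_pospowe theta : Omega theta ->
    (\int[nu]_x pospowe (1 + lambda * dot theta (F x))%R lambda^-1 =
     (expR (phi theta))%:E)%E.
  move=> Otheta; under eq_integral do rewrite -expqE.
  have I_ge0 : (0 <= \int[nu]_x expq (1 - lambda) (dot theta (F x)))%E.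
    by apply: integral_ge0 => x _; exact: pospowe_ge0.
  rewrite -[LHS]lneK; last by rewrite in_itv/= leey I_ge0.
  by rewrite -[lne _]fineK ?fin_pot.
have maff theta : measurable_fun setT (fun x => 1 + lambda * dot theta (F x)).
  apply: measurable_funD => //; apply: measurable_funM => //.
  by apply: measurable_sum => i; exact: measurable_funM.
have s01 : lambda^-1 < 0 \/ 1 <= lambda^-1.
  have [l0|l0|l0] := ltgtP lambda 0; last by move: lambda_neq0; rewrite l0 eqxx.
    by left; rewrite invr_lt0.
  by right; rewrite invf_ge1// ltW.
move=> t theta1 theta2 O1 O2.
have Oconv := Omega_convex theta1 theta2 t O1 O2.
(* The endpoints are set apart because the Minkowski step needs positive weights. *)
have [->|t_neq0] := eqVneq t 0%:i01; first by rewrite !conv0.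
have [->|t_neq1] := eqVneq t 1%:i01; first by rewrite !conv1.
have t0 : 0 < t%:num by rewrite lt_neqAle eq_sym t_neq0 ge0.
have t1 : 0 < 1 - t%:num by rewrite subr_gt0 lt_neqAle t_neq1 le1.
move: O1 O2 Oconv => /set_mem O1 /set_mem O2 /set_mem Oconv.
pose theta : 'rV[R]_n := t%:num *: theta1 + (1 - t%:num) *: theta2.
rewrite -[conv t _ _]/theta in Oconv.
(* The norms [Z^lambda] at the two ends. As [x |-> lambda^-1 * (x - 1)] is affine, it suffices to
   compare [Z^lambda] at [theta] with [c] after this map. *)
pose a := expR (lambda * phi theta1); pose b := expR (lambda * phi theta2).
pose c := t%:num * a + (1 - t%:num) * b.
suff le_c : lambda^-1 * (expR (lambda * phi theta) - 1) <= lambda^-1 * (c - 1).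
  apply: (le_trans le_c).
  suff -> : lambda^-1 * (c - 1) =
      t%:num * (lambda^-1 * (a - 1)) + (1 - t%:num) * (lambda^-1 * (b - 1)).
    exact: lexx.
  by rewrite /c; ring.
have potE v : expR (phi v) = expR (lambda * phi v) `^ lambda^-1.
  by rewrite -expRM mulrAC divff// mul1r.
have affE x : 1 + lambda * dot theta (F x) =
    t%:num * (1 + lambda * dot theta1 (F x)) +
    (1 - t%:num) * (1 + lambda * dot theta2 (F x)).
  by rewrite dotDl !dotZl; ring.
have c0 : 0 < c by rewrite addr_gt0// mulr_gt0// expR_gt0.
have expR_le : expR (phi theta) <= c `^ lambda^-1.
  rewrite -lee_fin -integral_pospowe//.
  under eq_integral do rewrite affE.
  apply: minkowski_pospowe => //; rewrite ?expR_gt0//.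
    by rewrite integral_pospowe// potE.
  by rewrite integral_pospowe// potE.
have phi_le : phi theta <= lambda^-1 * ln c.
  by rewrite -ler_expR (le_trans expR_le)// /powR gt_eqF.
(* For [lambda < 0] the factor [lambda^-1] reverses the goal, and multiplying [phi_le] by [lambda]
   reverses it too, so the directions agree. *)
have [l0|l0|l0] := ltgtP lambda 0; last by move: lambda_neq0; rewrite l0 eqxx.
  rewrite ler_nM2l ?invr_lt0// lerD2r -[leLHS]lnK ?posrE// ler_expR.
  by rewrite -ler_ndivlMl.
rewrite ler_pM2l ?invr_gt0// lerD2r -[leRHS]lnK ?posrE// ler_expR.
by rewrite -ler_pdivlMl.
Qed.

Lemma grad_divisive_potential_lt (N : nat) (theta : 'rV[R]_n) : (0 < N)%N ->
  diff_under_integral nu F lambda N -> Omega theta ->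
  0 < 1 - lambda * dot (grad phi theta) theta.
Proof.
move=> N_gt0 [smooth under_int] Otheta.
have dphi i : derivable phi theta (delta_mx 0 i).
  by apply: diff_derivable; exact: (smooth [::]).
have [h0 [ih0 h0E Zh0]] := under_int [::] theta isT Otheta.
(* Integrable versions [h i] of the first partial derivatives; the chain rule writes those of
   [exp phi] through [phi]. *)
have /choice[h hP] : forall i, exists h : X -> R,
    [/\ nu.-integrable setT (EFin \o h),
        {ae nu, forall x,
           derivable (integrand lambda (F x)) theta (delta_mx 0 i) /\
           'D_(delta_mx 0 i) (integrand lambda (F x)) theta = h x} &
        expR (phi theta) * 'D_(delta_mx 0 i) phi theta = \int[nu]_x h x].
  move=> i; have [|h [ih hE Zh]] := under_int [:: i] theta _ Otheta.
    exact: N_gt0.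
  exists h; split => //; last by rewrite -derive_expR_comp.
  by apply: filterS hE => x [[_ ?] ?].
have integrableZ (r : R) (g : X -> R) : nu.-integrable setT (EFin \o g) ->
    nu.-integrable setT (EFin \o (fun x => r * g x)).
  by move=> ig; exact: (integrableZl measurableT r ig).
have ithetah i : nu.-integrable setT (EFin \o (fun x => theta 0 i * h i x)).
  by apply: integrableZ; have [] := hP i.
pose k x := lambda * \sum_i theta 0 i * h i x.
have isum : nu.-integrable setT (EFin \o (fun x => \sum_i theta 0 i * h i x)).
  rewrite (_ : _ \o _ = fun x => (\sum_i (theta 0 i * h i x)%:E)%E); last first.
    by apply/funext => x /=; rewrite sumEFin.
  by apply: integrable_sum => // i _; exact: ithetah.
have ik : nu.-integrable setT (EFin \o k) by exact: integrableZ.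
have hE : {ae nu, forall x, forall i,
    derivable (integrand lambda (F x)) theta (delta_mx 0 i) /\
    'D_(delta_mx 0 i) (integrand lambda (F x)) theta = h i x}.
  by apply: filter_forall => i; have [] := hP i.
have wE : {ae nu, forall x, h0 x - k x =
    if 0 < 1 + lambda * dot theta (F x)
    then (1 + lambda * dot theta (F x)) `^ (lambda^-1 - 1) else 0}.
  apply: filterS2 h0E hE => x [_ <-] hE.
  rewrite -(euler_integrand lambda_neq0 (fun i => (hE i).1)).
  by congr (_ - _ * _); apply: eq_bigr => i _; have [_ ->] := hE i.
(* Positivity is applied to [w = h0 \- k], whose integral is [exp phi * (1 - lambda * dot (grad phi
   theta) theta)]. *)
have /(@Rintegral_gt0 _ _ _ _ h0) : nu.-integrable setT (EFin \o (h0 \- k)).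
  exact: (integrableB measurableT ih0 ik).
have Ik : \int[nu]_x k x =
    expR (phi theta) * (lambda * dot (grad phi theta) theta).
  rewrite RintegralZl// mulrCA; congr (_ * _).
  rewrite /Rintegral -[X in fine X]/(\int[nu]_x (\sum_i theta 0 i * h i x)%:E)%E.
  under eq_integral do rewrite -sumEFin.
  rewrite integral_sum// -sum_fine => [|i _]; last first.
    exact: integrable_fin_num (ithetah i).
  rewrite mulr_sumr; apply: eq_bigr => i _.
  have [ih _ Zh] := hP i.
  rewrite -[LHS]/(\int[nu]_x (theta 0 i * h i x))%R.
  by rewrite RintegralZl// -Zh mxE; ring.
move=> /(_ ih0).
rewrite RintegralB// Ik -Zh0 /= -/phi.
rewrite -[X in X - _]mulr1 -mulrBr pmulr_rgt0 ?expR_gt0//; apply.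
+ by apply: filterS wE => x /= ->; case: ifP => // _; exact: powR_ge0.
(* A power of a positive base is nonzero, so [w x = 0] forces a nonpositive base, where the
   integrand is [0]. *)
+ apply: filterS2 wE h0E => x /= -> [_ <-]; case: ltP => [v0 /eqP|v0 _].
    by rewrite gt_eqF// powR_gt0.
  exact: integrand_le0E.
+ by rewrite gt_eqF// expR_gt0.
Qed.

End divisive_potential.

Theorem theorem3p9 (R : realType) (d : measure_display) (X : measurableType d)
    (nu : {measure set X -> \bar R}) (n : nat) (F : X -> 'rV[R]_n)
    (lambda : R) (N : nat)
    (lambda_lt1 : lambda < 1) (lambda_neq0 : lambda != 0)
    (family : lambda_exponential_family nu F lambda)
    (Omega_nonempty : natural_parameters nu F lambda !=set0)
    (Omega_open : open (natural_parameters nu F lambda))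
    (Omega_convex : convex_set (natural_parameters nu F lambda))
    (N_ge2 : (2 <= N)%N)
    (smoothness : diff_under_integral nu F lambda N) :
  convex_function (natural_parameters nu F lambda)
    (fun theta =>
       lambda^-1 * (expR (lambda * real_potential nu F lambda theta) - 1)) /\
  (forall theta : 'rV[R]_n, natural_parameters nu F lambda theta ->
     0 < 1 - lambda * dot (grad (real_potential nu F lambda) theta) theta).
Proof.
split; first exact: convex_divisive_potential.
move=> theta; apply: (grad_divisive_potential_lt _ _ smoothness) => //.
exact: ltnW.
Qed.
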